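(* Let $G=(V,E)$ be a connected graph that admits a lower bound labelling. Then, for every $n \ge 3$, there is no wait-free asynchronous algorithm among $n$ processes communicating through shared read/write registers that solves graphical approximate agreement on $G$.
   Context: A labelling $\ell : V \to \{0,1,2\}$ is a lower bound labelling if (1) $G$ contains no triangle (3-clique) whose three vertices have three different labels, and (2) $G$ contains a cycle $C$ in which exactly one vertex has label $1$ and its two neighbours on $C$ have labels $0$ and $2$. Graphical approximate agreement on $G$: each process $p_i$ receives an input vertex $x_i\in V$ and each non-crashed process outputs $y_i\in V$ such that any two outputs are equal or adjacent in $G$ and every output lies on a shortest path in $G$ between two (not necessarily distinct) inputs. An algorithm is wait-free if every non-crashed process outputs after finitely many of its own steps, regardless of how many other processes crash. *)

(* Defs.v *)
From mathcomp Require Import all_boot.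
Set Implicit Arguments. Unset Strict Implicit. Unset Printing Implicit Defensive.

Definition simple_graph (V : finType) (e : rel V) : Prop :=
  symmetric e /\ irreflexive e.

Definition connected_graph (V : finType) (e : rel V) : Prop :=
  forall a b : V, connect e a b.

Definition on_shortest_path (V : finType) (e : rel V) (y a b : V) : Prop :=
  exists p : seq V,
    [/\ path e a p, last a p = b, y \in a :: p &
        forall q : seq V, path e a q -> last a q = b -> size p <= size q].

Definition labelling (V : finType) := V -> 'I_3.

Definition no_rainbow_triangle (V : finType) (e : rel V) (l : labelling V) : Prop :=
  forall u v w : V, e u v -> e v w -> e u w ->
    ~ [/\ l u != l v, l v != l w & l u != l w].

Definition graph_cycle (V : finType) (e : rel V) (c : seq V) : Prop :=
  ucycle e c /\ 3 <= size c.

Definition lb_cycle (V : finType) (e : rel V) (l : labelling V) (c : seq V) : Prop :=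
  graph_cycle e c /\
  count (fun v => nat_of_ord (l v) == 1) c = 1 /\
  (forall x, x \in c -> nat_of_ord (l x) = 1 ->
     (nat_of_ord (l (prev c x)) = 0 /\ nat_of_ord (l (next c x)) = 2) \/
     (nat_of_ord (l (prev c x)) = 2 /\ nat_of_ord (l (next c x)) = 0)).

Definition lower_bound_labelling (V : finType) (e : rel V) (l : labelling V) : Prop :=
  no_rainbow_triangle e l /\ exists c, lb_cycle e l c.

Inductive action (Reg Val St V : Type) :=
  | ARead of Reg & (Val -> St)
  | AWrite of Reg & Val & St
  | ADecide of V.

(* A deterministic algorithm for n processes with inputs/outputs in V,
   using arbitrarily many shared read/write (multi-writer, multi-reader)
   registers with arbitrary values and unbounded local computation. *)
Record algorithm (n : nat) (V : Type) := Algorithm {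
  alg_state : Type;
  alg_reg : eqType;
  alg_val : Type;
  alg_reg_init : alg_reg -> alg_val;
  alg_init : 'I_n -> V -> alg_state;
  alg_step : 'I_n -> alg_state -> action alg_reg alg_val alg_state V }.
Arguments alg_reg_init {n V} a _.
Arguments alg_init {n V} a _ _.
Arguments alg_step {n V} a _ _.

Record config (n : nat) (V : Type) (A : algorithm n V) := Config {
  lstate : 'I_n -> alg_state A;
  mem : alg_reg A -> alg_val A }.

Definition step_conf (n : nat) (V : Type) (A : algorithm n V) (i : 'I_n)
    (c : config A) : config A :=
  match alg_step A i (lstate c i) with
  | ARead r k =>
      Config (fun j => if j == i then k (mem c r) else lstate c j) (mem c)
  | AWrite r v s =>
      Config (fun j => if j == i then s else lstate c j)
             (fun r' => if r' == r then v else mem c r')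
  | ADecide _ => c
  end.

Fixpoint exec (n : nat) (V : Type) (A : algorithm n V) (x : 'I_n -> V)
    (sched : nat -> 'I_n) (t : nat) : config A :=
  match t with
  | 0 => Config (fun j => alg_init A j (x j)) (alg_reg_init A)
  | t'.+1 => step_conf (sched t') (exec A x sched t')
  end.

Definition decided (n : nat) (V : Type) (A : algorithm n V) (c : config A)
    (i : 'I_n) (y : V) : Prop :=
  alg_step A i (lstate c i) = ADecide _ _ _ y.

(* Wait-freedom: in every execution, every process taking infinitely many
   steps (i.e. every non-crashed process, whatever the others do) decides after
   finitely many steps. *)
Definition wait_free (n : nat) (V : Type) (A : algorithm n V) : Prop :=
  forall (x : 'I_n -> V) (sched : nat -> 'I_n) (i : 'I_n),
    (forall N, exists t, N <= t /\ sched t = i) ->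
    exists t y, decided (exec A x sched t) i y.

Definition solves_gaa (n : nat) (V : finType) (e : rel V) (A : algorithm n V) : Prop :=
  wait_free A /\
  (forall x sched t (i j : 'I_n) yi yj,
     decided (exec A x sched t) i yi -> decided (exec A x sched t) j yj ->
     yi = yj \/ e yi yj) /\
  (forall x sched t (i : 'I_n) y,
     decided (exec A x sched t) i y ->
     exists a b : 'I_n, on_shortest_path e y (x a) (x b)).

(* Main.v *)
From Stdlib Require Import ZArith Lia Classical ClassicalEpsilon FunctionalExtensionality.
Require Import Defs.
From mathcomp Require Import all_boot.
Set Implicit Arguments. Unset Strict Implicit. Unset Printing Implicit Defensive.

(** Run three processes on inputs [a], [b], [d].  For two processes [p], [q] and
a configuration [c], the executions of [p] and [q] alone from [c] contain a path
of outputs, consecutive ones equal or adjacent, from the output of [p] running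
solo to that of [q] running solo.  Count, with sign, how often this path crosses
from label 0 to label 1.  As no triangle of the graph carries three labels, these
numbers satisfy the cocycle identity for any three processes, by induction on
the (bounded, by wait-freedom) executions and by inspection of how the three
pending read/write operations conflict.  In the initial configurations the
number for [p] and [q] depends only on their two inputs, so the cocycle identity
with the third input fixed makes it a difference [h a - h b] of a potential.  By
validity it is the crossing number of the edge when [a] and [b] are adjacent.
Hence crossings sum to zero along every cycle, whereas the given cycle has total
crossing number 1 or -1. *)

(** * Single steps, decisions and indistinguishable configurations *)

Section Executions.
Variables (n : nat) (V : Type) (A : algorithm n V).
Implicit Types (c : config A) (p q i : 'I_n) (x : 'I_n -> V).

Local Notation "c @@ i" := (step_conf i c) (at level 40, left associativity).

Definition pending p c : option (alg_reg A * bool) :=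
  match alg_step A p (lstate c p) with
  | ARead r _ => Some (r, false)
  | AWrite r _ _ => Some (r, true)
  | ADecide _ => None
  end.

Definition undecided p c : bool := pending p c.

Definition init x : config A := Config (fun j => alg_init A j (x j)) (alg_reg_init A).

(** Indistinguishability for the processes in [S]: as long as only these move, both configurations
    evolve alike ([agree_step]). *)
Definition agree (S : pred 'I_n) c c' : Prop :=
  (forall i, S i -> lstate c i = lstate c' i) /\ Defs.mem c = Defs.mem c'.

Lemma lstate_step p q c : q != p -> lstate (c @@ p) q = lstate c q.
Proof.
rewrite /step_conf => /negbTE nqp.
by case: (alg_step A p (lstate c p)) => [r k|r v s|y] //=; rewrite nqp.
Qed.

Lemma step_decided p c : ~~ undecided p c -> c @@ p = c.
Proof.
rewrite /undecided /pending /step_conf.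
by case: (alg_step A p (lstate c p)).
Qed.

Lemma decided_undecided p c y : decided c p y -> undecided p c = false.
Proof. by rewrite /decided /undecided /pending => ->. Qed.

Lemma undecidedPn p c : undecided p c = false -> exists y, decided c p y.
Proof.
rewrite /decided /undecided /pending.
by case: (alg_step A p (lstate c p)) => // y _; exists y.
Qed.

Lemma decided_step p i c y : decided c p y -> decided (c @@ i) p y.
Proof.
move=> dp; have [-> | neq_pi] := eqVneq i p.
  by rewrite step_decided // (decided_undecided dp).
by rewrite /decided lstate_step // eq_sym.
Qed.

Lemma pending_lstate p c c' : lstate c p = lstate c' p -> pending p c = pending p c'.
Proof. by rewrite /pending => ->. Qed.

Lemma undecided_lstate p c c' :
  lstate c p = lstate c' p -> undecided p c = undecided p c'.
Proof. by move=> eq_p; rewrite /undecided (pending_lstate eq_p). Qed.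

Lemma agree_step (S : pred 'I_n) c c' i :
  S i -> agree S c c' -> agree S (c @@ i) (c' @@ i).
Proof.
move=> Si [eqS eqm]; rewrite /step_conf -(eqS i Si).
by case: (alg_step A i (lstate c i)) => [r k|r v s|y]; split=> [j Sj|] //=;
  rewrite ?eqm ?(eqS j).
Qed.

Lemma agreeS (S S' : pred 'I_n) c c' :
  subpred S S' -> agree S' c c' -> agree S c c'.
Proof. by move=> sSS' [eqS eqm]; split=> // i /sSS'/eqS. Qed.

(** * Bounded executions *)

(** At most [k] effective steps remain, whatever the schedule; a step of a decided process changes
    nothing and is not counted. *)
Fixpoint bounded k c : Prop :=
  if k is k'.+1 then forall i, undecided i c -> bounded k' (c @@ i)
  else forall i, ~~ undecided i c.

Lemma boundedS k c : bounded k c -> bounded k.+1 c.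
Proof.
elim: k c => [|k IHk] c /= bc i ui; first by move: (bc i); rewrite ui.
by apply: IHk; apply: bc.
Qed.

Lemma bounded_leq k k' c : k <= k' -> bounded k c -> bounded k' c.
Proof.
move=> /subnK <-; elim: (k' - k) => // m IHm bc.
by apply: boundedS; apply: IHm.
Qed.

Lemma bounded_step k c i : bounded k c -> bounded k (c @@ i).
Proof.
case ui: (undecided i c); last by rewrite step_decided ?ui.
case: k => [|k] bc; first by move: (bc i); rewrite ui.
by apply: boundedS; apply: bc.
Qed.

(** Pigeonhole: otherwise every process has a time after which it never moves, and nobody could move
    at the maximum of these times. *)
Lemma infinitely_often (sched : nat -> 'I_n) :
  exists i, forall N, exists t, N <= t /\ sched t = i.
Proof.
apply: NNPP => noi.
have fin i : exists N, forall t, N <= t -> sched t <> i.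
  apply: NNPP => noN; apply: noi; exists i => N; apply: NNPP => not.
  by apply: noN; exists N => t leNt eqi; apply: not; exists t.
have [N Nlast] : exists N : 'I_n -> nat, forall i t, N i <= t -> sched t <> i.
  exists (fun i => proj1_sig (constructive_indefinite_description _ (fin i))).
  by move=> i; case: constructive_indefinite_description.
exact: (Nlast _ (\max_i N i) (leq_bigmax (F := N) (sched (\max_i N i)))).
Qed.

(* Otherwise always stepping an undecided process into an unbounded
   configuration never ends, yet some process moves infinitely often. *)
Lemma wait_free_bounded x : wait_free A -> exists k, bounded k (init x).
Proof.
move=> wf; apply: NNPP => unb.
have next c : ~ (exists k, bounded k c) ->
    exists i, undecided i c /\ ~ (exists k, bounded k (c @@ i)).
  move=> nb; apply: NNPP => noi; apply: nb.
  (* With the premise under the existential, a bound can be chosen for every process, decided or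
     not; the maximum of these bounds then serves all. *)
  have bi i : exists k, undecided i c -> bounded k (c @@ i).
    case ui: (undecided i c); last by exists 0.
    apply: NNPP => nok; apply: noi; exists i; split=> // -[k bk].
    by apply: nok; exists k.
  have [k kP] : exists k : 'I_n -> nat, forall i, undecided i c -> bounded (k i) (c @@ i).
    exists (fun i => proj1_sig (constructive_indefinite_description _ (bi i))).
    by move=> i; case: constructive_indefinite_description.
  exists (\max_i k i).+1 => i /kP; apply: bounded_leq.
  exact: (leq_bigmax (F := k) i).
have [i0 _] := next _ unb.
pose pick c := epsilon (inhabits i0)
  (fun i => undecided i c /\ ~ (exists k, bounded k (c @@ i))).
have pickP c : ~ (exists k, bounded k c) ->
    undecided (pick c) c /\ ~ (exists k, bounded k (c @@ pick c)).
  by move=> /next; apply: epsilon_spec.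
pose conf t := iter t (fun c => c @@ pick c) (init x).
pose sched t := pick (conf t).
have execE t : exec A x sched t = conf t by elim: t => //= t ->.
have unb_conf t : ~ exists k, bounded k (conf t).
  by elim: t => //= t /pickP [].
have [i inf_i] := infinitely_often sched.
have [t [y]] := wf x sched i inf_i.
rewrite execE => dty.
have dec m : decided (conf (m + t)) i y.
  by elim: m => //= m; apply: decided_step.
have [t' [le_tt' eq_i]] := inf_i t.
have := dec (t' - t); rewrite subnK // => /decided_undecided.
by rewrite -eq_i; have [-> _] := pickP _ (unb_conf t').
Qed.

(** * Reachable configurations *)

Definition reachable x c : Prop := exists sched t, c = exec A x sched t.

Lemma reachable_init x (i0 : 'I_n) : reachable x (init x).
Proof. by exists (fun=> i0), 0. Qed.

Lemma reachable_step x c i : reachable x c -> reachable x (c @@ i).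
Proof.
move=> [sched [t ->]]; exists (fun s => if s < t then sched s else i), t.+1 => /=.
rewrite ltnn; congr step_conf.
have: forall m, m <= t ->
    exec A x sched m = exec A x (fun s => if s < t then sched s else i) m.
  by elim=> //= m IHm ltmt; rewrite ltmt IHm // ltnW.
exact.
Qed.

(** * Conflicts between pending operations *)

(* A step of [q] taken right after one of [p] erases the latter
   from the memory, or [q] is not running any more.  Two writes to the same
   register erase each other; the indices break this tie. *)
Definition hidden p q c : bool :=
  match pending p c, pending q c with
  | None, _ => false
  | Some _, None => true
  | Some (r, w), Some (r', w') => [&& r == r', w' & ~~ w || (p < q)]
  end.

Definition commuting p q c : bool :=
  [&& undecided p c, undecided q c, ~~ hidden p q c & ~~ hidden q p c].

Lemma hidden_undecided p q c : hidden p q c -> undecided p c.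
Proof. by rewrite /hidden /undecided; case: (pending p c). Qed.

Lemma commutingC p q c : commuting p q c = commuting q p c.
Proof. by rewrite /commuting; do !case: (_ c). Qed.

Lemma hidden_lstate p q c c' :
  lstate c p = lstate c' p -> lstate c q = lstate c' q ->
  hidden p q c = hidden p q c'.
Proof. by move=> /pending_lstate eqp /pending_lstate eqq; rewrite /hidden eqp eqq. Qed.

Lemma commuting_lstate p q c c' :
  lstate c p = lstate c' p -> lstate c q = lstate c' q ->
  commuting p q c = commuting p q c'.
Proof.
move=> eqp eqq; rewrite /commuting (hidden_lstate eqp eqq) (hidden_lstate eqq eqp).
by rewrite (undecided_lstate eqp) (undecided_lstate eqq).
Qed.

Lemma hidden_asym p q c : hidden p q c -> hidden q p c = false.
Proof.
rewrite /hidden; case: (pending p c) => [[r w]|] //.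
case: (pending q c) => [[r' w']|] //.
case/and3P=> /eqP <- ->; rewrite eqxx /=; case: w => //= lt_pq.
by rewrite ltnNge ltnW.
Qed.

(** Together with [hidden_asym], this makes [hidden] a strict partial order on the processes. *)
Lemma hidden_trans q p s c : hidden p q c -> hidden q s c -> hidden p s c.
Proof.
rewrite /hidden; case: (pending p c) => [[r w]|] //.
case: (pending q c) => [[r' w']|] //.
case: (pending s c) => [[r'' w'']|] //.
case/and3P=> /eqP-> -> /= lt_pq /and3P[-> -> /=].
by move: lt_pq; case: w => //=; apply: ltn_trans.
Qed.

(** Running processes that both hide [p] are about to write to the same register, so the index order
    makes one of them hide the other. *)
Lemma hidden2_not_commuting p q s c :
  q != s -> hidden p q c -> hidden p s c -> commuting q s c = false.
Proof.
rewrite /commuting /undecided /hidden neq_ltn.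
case: (pending p c) => [[r w]|] //; case: (pending q c) => [[r' w']|] //.
case: (pending s c) => [[r'' w'']|] //= neq_qs.
case/and3P=> /eqP<- -> _ /and3P[/eqP<- -> _]; rewrite eqxx /=.
by case/orP: neq_qs => ->; rewrite // andbF.
Qed.

Lemma pair_cases p q c :
  [\/ hidden p q c, hidden q p c, commuting p q c |
      undecided p c = false /\ undecided q c = false].
Proof.
rewrite /commuting; case hpq: (hidden p q c); first by constructor 1.
case hqp: (hidden q p c); first by constructor 2.
case up: (undecided p c); case uq: (undecided q c); try by constructor 3.
- by move: up uq hpq; rewrite /undecided /hidden; do 2!case: (pending _ c) => [[]|].
- by move: up uq hqp; rewrite /undecided /hidden; do 2!case: (pending _ c) => [[]|].
by constructor 4.
Qed.

(** Only [p] remembers its step: a read leaves the memory unchanged, and a write is erased when [q]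
    writes to the same register. A decided [q] would erase nothing. *)
Lemma hidden_agree p q c :
  p != q -> hidden p q c -> undecided q c -> agree (predC1 p) (c @@ p @@ q) (c @@ q).
Proof.
move=> neq_pq; have neq_qp : q != p by rewrite eq_sym.
rewrite /hidden /undecided /pending => hpq uq.
split=> [i /= nip|].
  have [-> {i nip}|niq] := eqVneq i q.
    rewrite /step_conf; move: hpq uq.
    case: (alg_step A p (lstate c p)) => [r k|r v s|y] //=; rewrite (negbTE neq_qp);
      by case: (alg_step A q (lstate c q)) => [r' k'|r' v' s'|y'] //=;
        rewrite ?eqxx ?andbF.
  by rewrite !lstate_step.
rewrite /step_conf; move: hpq uq.
case: (alg_step A p (lstate c p)) => [r k|r v s|y] //=; rewrite (negbTE neq_qp);
  case: (alg_step A q (lstate c q)) => [r' k'|r' v' s'|y'] //=; rewrite ?andbF //.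
case/andP=> /eqP-> _ _; apply: functional_extensionality => r2.
by case: (r2 == r').
Qed.

(** Two pending operations neither of which hides the other are two reads or concern different
    registers. *)
Lemma commuting_step p q c : p != q -> commuting p q c -> c @@ p @@ q = c @@ q @@ p.
Proof.
move=> neq_pq; have neq_qp : q != p by rewrite eq_sym.
rewrite /commuting /hidden /undecided /pending /step_conf.
case Ep: (alg_step A p (lstate c p)) => [r k|r v s|y] //=;
case Eq: (alg_step A q (lstate c q)) => [r' k'|r' v' s'|y'] //=;
  rewrite ?(negbTE neq_pq) ?(negbTE neq_qp) ?Ep ?Eq //= => nh.
- congr Config; apply: functional_extensionality => i.
  by have [->|//] := eqVneq i p; rewrite (negbTE neq_pq).
- congr Config; apply: functional_extensionality => i.
  have [->|//] := eqVneq i p; rewrite (negbTE neq_pq).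
  by move: nh; case: (r == r').
- congr Config; apply: functional_extensionality => i.
  have [->|_] := eqVneq i p; first by rewrite (negbTE neq_pq).
  by move: nh; case: (r' == r); rewrite ?andbF.
congr Config; apply: functional_extensionality => i.
  by have [->|//] := eqVneq i p; rewrite (negbTE neq_pq).
have [->|//] := eqVneq i r'; have [eq_r|//] := eqVneq r' r.
by move: nh; rewrite eq_r eqxx /= -negb_or -neq_ltn neq_pq.
Qed.

(** * Winding along two-process executions *)

Variable w : V -> V -> Z.
Hypothesis wC : forall u v, w u v = (- w v u)%Z.

(** The value 0 is a default: by [pair_cases], [winding] meets it only when its fuel is too
    small. *)
Definition decision_winding p q c : Z :=
  match alg_step A p (lstate c p), alg_step A q (lstate c q) with
  | ADecide u, ADecide v => w u v
  | _, _ => 0%Z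
  end.

(* The sum of [w] along a path of outputs, consecutive ones being produced by
   some common execution of [p] and [q] from [c], which leads from the output of
   a solo run of [p] to the output of a solo run of [q].  The fuel [k] is
   irrelevant as soon as it bounds the executions from [c]. *)
Fixpoint winding k p q c : Z :=
  if k is k'.+1 then
    if hidden p q c then winding k' p q (c @@ p)
    else if hidden q p c then winding k' p q (c @@ q)
    else if commuting p q c then
      (winding k' p q (c @@ p) - winding k' p q (c @@ p @@ q)
       + winding k' p q (c @@ q))%Z
    else decision_winding p q c
  else decision_winding p q c.

Lemma windingS k p q c : winding k.+1 p q c =
  if hidden p q c then winding k p q (c @@ p)
  else if hidden q p c then winding k p q (c @@ q)
  else if commuting p q c then
    (winding k p q (c @@ p) - winding k p q (c @@ p @@ q) + winding k p q (c @@ q))%Z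
  else decision_winding p q c.
Proof. by []. Qed.

(** Exchanging the processes reverses the path of outputs; in the commuting case the middle
    configuration does not depend on the order of the steps. *)
Lemma windingC k p q c : p != q -> winding k p q c = (- winding k q p c)%Z.
Proof.
move=> neq_pq; elim: k c => [|k IHk] c /=.
  by rewrite /decision_winding; do 2!case: alg_step => //= ?.
case hpq: (hidden p q c); first by rewrite (hidden_asym hpq).
case hqp: (hidden q p c) => //; rewrite (commutingC q p).
case cpq: (commuting p q c).
  by rewrite -(commuting_step neq_pq cpq) !IHk; lia.
by rewrite /decision_winding; do 2!case: alg_step => //= ?.
Qed.

Lemma winding_agree k p q c c' :
  agree (pred2 p q) c c' -> winding k p q c = winding k p q c'.
Proof.
have Pp : pred2 p q p by rewrite /= eqxx.
have Pq : pred2 p q q by rewrite /= eqxx orbT.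
have dec c1 c2 : agree (pred2 p q) c1 c2 ->
    decision_winding p q c1 = decision_winding p q c2.
  by case=> eqS _; rewrite /decision_winding (eqS p) // (eqS q).
elim: k c c' => [|k IHk] c c' ag /=; first exact: dec.
have [eqp eqq] := (ag.1 p Pp, ag.1 q Pq).
rewrite (hidden_lstate eqp eqq) (hidden_lstate eqq eqp) (commuting_lstate eqp eqq).
have agp := agree_step Pp ag; have agq := agree_step Pq ag.
by rewrite (IHk _ _ agp) (IHk _ _ agq) (IHk _ _ (agree_step Pq agp)) (dec _ _ ag).
Qed.

Lemma winding_fuel k p q c : bounded k c -> winding k.+1 p q c = winding k p q c.
Proof.
elim: k c => [|k IHk] c bc.
  have nu i : undecided i c = false by apply/negbTE/bc.
  rewrite /= /commuting nu.
  by do 2![case: ifP => [/hidden_undecided|_]; rewrite ?nu //].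
rewrite windingS [RHS]windingS.
case: ifP => [/hidden_undecided/bc/IHk //|_].
case: ifP => [/hidden_undecided/bc/IHk //|_].
case: ifP => // /and4P[/bc bp /bc bq _ _].
by rewrite (IHk _ bp) (IHk _ bq) (IHk _ (bounded_step q bp)).
Qed.

(** * The cocycle identity for three processes *)

Section Cocycle.
Variable F : nat.
Local Notation W := (winding F).

Lemma winding_hidden p q c :
  bounded F c -> hidden p q c -> W p q c = W p q (c @@ p).
Proof. by move=> bc hpq; rewrite -(winding_fuel p q bc) /= hpq. Qed.

Lemma winding_commuting p q c : bounded F c -> commuting p q c ->
  W p q c = (W p q (c @@ p) - W p q (c @@ p @@ q) + W p q (c @@ q))%Z.
Proof.
move=> bc cpq; rewrite -(winding_fuel p q bc) /= cpq.
by case/and4P: cpq => _ _ /negbTE-> /negbTE->.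
Qed.

Lemma winding_decided p q c u v :
  bounded F c -> decided c p u -> decided c q v -> W p q c = w u v.
Proof.
move=> bc du dv; rewrite -(winding_fuel p q bc) /= /commuting (decided_undecided du).
case: ifP => [/hidden_undecided|_]; first by rewrite (decided_undecided du).
case: ifP => [/hidden_undecided|_]; first by rewrite (decided_undecided dv).
by rewrite /decision_winding du dv.
Qed.

Definition cocycle c : Prop := forall a b d, a != b -> b != d -> d != a ->
  (W a b c + W b d c + W d a c = 0)%Z.

Section Patterns.
Variables (c : config A) (a b d : 'I_n).
Hypotheses (neq_ab : a != b) (neq_bd : b != d) (neq_da : d != a).
Hypothesis bc : bounded F c.

Let nba : b != a. Proof. by rewrite eq_sym. Qed.
Let ndb : d != b. Proof. by rewrite eq_sym. Qed.
Let nad : a != d. Proof. by rewrite eq_sym. Qed.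

Let bounded_cs i : bounded F (c @@ i) := bounded_step i bc.

Let hidden_step i p q : p != i -> q != i -> hidden p q (c @@ i) = hidden p q c.
Proof. by move=> *; apply: hidden_lstate; apply: lstate_step. Qed.

Let commuting_cs i p q : p != i -> q != i -> commuting p q (c @@ i) = commuting p q c.
Proof. by move=> *; apply: commuting_lstate; apply: lstate_step. Qed.

Let hidden_winding p q s : p != q -> s != p -> hidden p q c -> undecided q c ->
  W q s (c @@ p @@ q) = W q s (c @@ q).
Proof.
move=> neq_pq neq_sp hpq uq; apply: winding_agree.
apply: agreeS (hidden_agree neq_pq hpq uq) => i /= /pred2P[]-> //.
by rewrite eq_sym.
Qed.

(** All three windings are the same at [c] as at [c @@ a]; for [W b d] this is because [b] and [d]
    cannot see a step of [a] followed by one of [b]. *)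
Lemma cocycle_chain : hidden a b c -> hidden b d c ->
  cocycle (c @@ a) -> (W a b c + W b d c + W d a c = 0)%Z.
Proof.
move=> hab hbd /(_ a b d neq_ab neq_bd neq_da) Ta.
have had := hidden_trans hab hbd; have ub := hidden_undecided hbd.
have E1 := winding_hidden bc hab; have E2 := winding_hidden bc hbd.
have E3 := winding_hidden bc had.
have E4 : W b d (c @@ a) = W b d (c @@ a @@ b).
  by apply: winding_hidden; rewrite ?hidden_step.
have E5 := hidden_winding neq_ab neq_da hab ub.
have S1 := windingC F (c @@ a) neq_da; have S2 := windingC F c neq_da.
lia.
Qed.

(** The sum at [c] is the sum at [c @@ a] plus that at [c @@ b] minus that at [c @@ a @@ b]. A
    winding with [d] is unaffected by the extra step that its two processes do not take part in,
    once its own hidden step is added. *)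
Lemma cocycle_top : hidden a d c -> hidden b d c -> commuting a b c ->
  cocycle (c @@ a) -> cocycle (c @@ b) -> cocycle (c @@ a @@ b) ->
  (W a b c + W b d c + W d a c = 0)%Z.
Proof.
move=> had hbd cab /(_ a b d neq_ab neq_bd neq_da) Ta.
move=> /(_ a b d neq_ab neq_bd neq_da) Tb /(_ a b d neq_ab neq_bd neq_da) Tab.
have E1 := winding_commuting bc cab; have E2 := winding_hidden bc hbd.
have E3 := winding_hidden bc had.
have E4 : W b d (c @@ a) = W b d (c @@ a @@ b).
  by apply: winding_hidden; rewrite ?hidden_step.
have E5 : W a d (c @@ b) = W a d (c @@ a @@ b).
  by rewrite (commuting_step neq_ab cab); apply: winding_hidden; rewrite ?hidden_step.
have S1 := windingC F (c @@ a) neq_da; have S2 := windingC F c neq_da.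
have S3 := windingC F (c @@ b) neq_da; have S4 := windingC F (c @@ a @@ b) neq_da.
lia.
Qed.

(** The sum at [c] is the sum at [c @@ a] plus that at [c @@ d] minus that at [c @@ a @@ d]. For
    [W b d], the terms after a step of [b] do not depend on whether [a] moved first. *)
Lemma cocycle_single : hidden a b c -> commuting a d c -> commuting b d c ->
  cocycle (c @@ a) -> cocycle (c @@ d) -> cocycle (c @@ a @@ d) ->
  (W a b c + W b d c + W d a c = 0)%Z.
Proof.
move=> hab cad cbd /(_ a b d neq_ab neq_bd neq_da) Ta.
move=> /(_ a b d neq_ab neq_bd neq_da) Td /(_ a b d neq_ab neq_bd neq_da) Tad.
have ub : undecided b c by case/and4P: cbd.
have E1 := winding_hidden bc hab; have E2 := winding_commuting bc cad.
have E3 := winding_commuting bc cbd.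
have E4 : W b d (c @@ a) = (W b d (c @@ a @@ b) - W b d (c @@ a @@ b @@ d)
    + W b d (c @@ a @@ d))%Z.
  by apply: winding_commuting; rewrite ?commuting_cs.
have E5 := hidden_winding neq_ab neq_da hab ub.
have E6 : W b d (c @@ a @@ b @@ d) = W b d (c @@ b @@ d).
  apply: winding_agree; apply: agree_step; first by rewrite /= eqxx orbT.
  by apply: agreeS (hidden_agree neq_ab hab ub) => i /= /pred2P[]->.
have E7 : W a b (c @@ d) = W a b (c @@ a @@ d).
  by rewrite (commuting_step nad cad); apply: winding_hidden; rewrite ?hidden_step.
have S1 := windingC F (c @@ a) neq_da; have S2 := windingC F c neq_da.
have S3 := windingC F (c @@ d) neq_da; have S4 := windingC F (c @@ a @@ d) neq_da.
lia.
Qed.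

(** Inclusion-exclusion: the sum at [c] is that over the single steps, minus that over the pairs of
    steps, plus that at [c @@ a @@ b @@ d]. *)
Lemma cocycle_commuting : commuting a b c -> commuting b d c -> commuting a d c ->
  (forall i, undecided i c -> cocycle (c @@ i)) ->
  (forall i j, undecided i c -> cocycle (c @@ i @@ j)) ->
  (forall i j k, undecided i c -> cocycle (c @@ i @@ j @@ k)) ->
  (W a b c + W b d c + W d a c = 0)%Z.
Proof.
move=> cab cbd cad T1 T2 T3; have /and4P[ua ub _ _] := cab.
have /and4P[_ ud _ _] := cad.
have Ta := T1 a ua a b d neq_ab neq_bd neq_da.
have Tb := T1 b ub a b d neq_ab neq_bd neq_da.
have Td := T1 d ud a b d neq_ab neq_bd neq_da.
have Tab := T2 a b ua a b d neq_ab neq_bd neq_da.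
have Tbd := T2 b d ub a b d neq_ab neq_bd neq_da.
have Tad := T2 a d ua a b d neq_ab neq_bd neq_da.
have Tabd := T3 a b d ua a b d neq_ab neq_bd neq_da.
have E1 := winding_commuting bc cab; have E2 := winding_commuting bc cbd.
have E3 := winding_commuting bc cad.
have E4 : W b d (c @@ a) = (W b d (c @@ a @@ b) - W b d (c @@ a @@ b @@ d)
    + W b d (c @@ a @@ d))%Z.
  by apply: winding_commuting; rewrite ?commuting_cs.
have E5 : W a d (c @@ b) = (W a d (c @@ a @@ b) - W a d (c @@ a @@ b @@ d)
    + W a d (c @@ b @@ d))%Z.
  rewrite (commuting_step neq_ab cab).
  by apply: winding_commuting; rewrite ?commuting_cs.
have E6 : W a b (c @@ d) = (W a b (c @@ a @@ d) - W a b (c @@ a @@ b @@ d)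
    + W a b (c @@ b @@ d))%Z.
  have -> : c @@ a @@ b @@ d = c @@ d @@ a @@ b.
    by rewrite -(commuting_step nad cad) (commuting_step neq_bd) ?commuting_cs.
  rewrite (commuting_step nad cad) (commuting_step neq_bd cbd).
  by apply: winding_commuting; rewrite ?commuting_cs.
have S0 := windingC F c neq_da; have S1 := windingC F (c @@ a) neq_da.
have S2 := windingC F (c @@ b) neq_da; have S3 := windingC F (c @@ d) neq_da.
have S4 := windingC F (c @@ a @@ b) neq_da; have S5 := windingC F (c @@ b @@ d) neq_da.
have S6 := windingC F (c @@ a @@ d) neq_da.
have S7 := windingC F (c @@ a @@ b @@ d) neq_da.
lia.
Qed.

(** Both decided processes hide [d], so a step of [d] changes none of the three windings. *)
Lemma cocycle_last : undecided a c = false -> undecided b c = false ->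
  undecided d c -> cocycle (c @@ d) -> (W a b c + W b d c + W d a c = 0)%Z.
Proof.
move=> nua nub ud /(_ a b d neq_ab neq_bd neq_da) Td.
have hid p : undecided p c = false -> hidden d p c.
  by move: ud; rewrite /hidden /undecided; case: (pending p c); case: (pending d c) => [[]|].
have [u du] := undecidedPn nua; have [v dv] := undecidedPn nub.
have E1 := winding_decided bc du dv.
have E2 := winding_decided (bounded_cs d) (decided_step d du) (decided_step d dv).
have E3 := winding_hidden bc (hid _ nua); have E4 := winding_hidden bc (hid _ nub).
have S1 := windingC F c neq_bd; have S2 := windingC F (c @@ d) neq_bd.
lia.
Qed.

End Patterns.

(* Up to a permutation of [a], [b] and [d], the five patterns above exhaust the
   possible conflicts among three pending operations. *)
Lemma reachable_cocycle x :
  (forall c a b d u v t, reachable x c ->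
     decided c a u -> decided c b v -> decided c d t ->
     (w u v + w v t + w t u = 0)%Z) ->
  forall k c, bounded k c -> bounded F c -> reachable x c -> cocycle c.
Proof.
move=> wT.
have decided3 c a b d : bounded F c -> reachable x c -> undecided a c = false ->
    undecided b c = false -> undecided d c = false ->
    (W a b c + W b d c + W d a c = 0)%Z.
  move=> bF rc /undecidedPn[u du] /undecidedPn[v dv] /undecidedPn[t dt].
  rewrite (winding_decided bF du dv) (winding_decided bF dv dt).
  by rewrite (winding_decided bF dt du) (wT c a b d).
elim=> [|k IHk] c bk bF rc a b d nab nbd nda.
  by apply: decided3 => //; apply/negbTE/bk.
have T1 i : undecided i c -> cocycle (c @@ i).
  by move=> ui; apply: IHk; [apply: bk|apply: bounded_step|apply: reachable_step].
have T2 i j : undecided i c -> cocycle (c @@ i @@ j).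
  move=> ui; apply: IHk; last by do 2!apply: reachable_step.
    by apply: bounded_step; apply: bk.
  by do 2!apply: bounded_step.
have T3 i j m : undecided i c -> cocycle (c @@ i @@ j @@ m).
  move=> ui; apply: IHk; last by do 3!apply: reachable_step.
    by do 2!apply: bounded_step; apply: bk.
  by do 3!apply: bounded_step.
have chain p q s : p != q -> q != s -> s != p -> hidden p q c -> hidden q s c ->
    (W p q c + W q s c + W s p c = 0)%Z.
  by move=> ? ? ? hpq hqs; apply: cocycle_chain => //; apply/T1/(hidden_undecided hpq).
have top p q s : p != q -> q != s -> s != p -> hidden p s c -> hidden q s c ->
    commuting p q c -> (W p q c + W q s c + W s p c = 0)%Z.
  move=> ? ? ? hps hqs cpq; have [up uq] := (hidden_undecided hps, hidden_undecided hqs).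
  by apply: cocycle_top => //; [apply: T1|apply: T1|apply: T2].
have single p q s : p != q -> q != s -> s != p -> hidden p q c ->
    commuting p s c -> commuting q s c -> (W p q c + W q s c + W s p c = 0)%Z.
  move=> ? ? ? hpq cps cqs; have /and4P[up us _ _] := cps.
  by apply: cocycle_single => //; [apply: T1|apply: T1|apply: T2].
have all_commuting p q s : p != q -> q != s -> s != p -> commuting p q c ->
    commuting q s c -> commuting p s c -> (W p q c + W q s c + W s p c = 0)%Z.
  by move=> *; apply: cocycle_commuting.
have two_decided p q s : p != q -> q != s -> s != p ->
    undecided p c = false -> undecided q c = false ->
    (W p q c + W q s c + W s p c = 0)%Z.
  move=> npq nqs nsp nup nuq; case us: (undecided s c); last exact: decided3.
  by apply: cocycle_last => //; apply: T1.
have no_fork p q s : q != s -> hidden p q c -> hidden p s c -> ~ commuting q s c.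
  by move=> nqs hpq hps; rewrite (hidden2_not_commuting nqs hpq hps).
have nba : b != a by rewrite eq_sym.
have ndb : d != b by rewrite eq_sym.
have nad : a != d by rewrite eq_sym.
have Sab := windingC F c nab; have Sbd := windingC F c nbd.
have Sda := windingC F c nda.
have comC p q : commuting p q c -> commuting q p c by rewrite commutingC.
have [hab|hab|hab|[ua ub]] := pair_cases a b c; last by apply: two_decided.
all: have [hbd|hbd|hbd|[ub ud]] := pair_cases b d c;
  try by have := two_decided _ _ _ nbd nda nab ub ud; lia.
all: have [had|had|had|[ua ud]] := pair_cases a d c;
  try by have := two_decided _ _ _ nda nab nbd ud ua; lia.
all: try have hba := comC _ _ hab.
all: try have hdb := comC _ _ hbd.
all: try have hda := comC _ _ had.
(* Each remaining case contains one of the patterns for some order of the processes, or the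
   impossible fork; antisymmetry turns the identity for that order into the goal. *)
all: match goal with
  | H : is_true (hidden ?p ?q _), H' : is_true (hidden ?q ?s _) |- _ =>
    have := chain p q s
  | H : is_true (hidden ?p ?s _), H' : is_true (hidden ?q ?s _),
    H'' : is_true (commuting ?p ?q _) |- _ => have := top p q s
  | H : is_true (hidden ?p ?q _), H' : is_true (hidden ?p ?s _),
    H'' : is_true (commuting ?q ?s _) |- _ => have := no_fork p q s
  | H : is_true (hidden ?p ?q _), H' : is_true (commuting ?p ?s _),
    H'' : is_true (commuting ?q ?s _) |- _ => have := single p q s
  | _ => have := all_commuting a b d
  end.
all: do ?[move=> /(_ ltac:(assumption))].
all: lia.
Qed.

(** * Solo runs and the winding of a coboundary *)

Section Boundary.
Variable chi : V -> Z.

(* The value of [chi] on the output of the solo run of [p]; the fuel plays the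
   same role as in [winding]. *)
Fixpoint solo k p c : Z :=
  match alg_step A p (lstate c p) with
  | ADecide y => chi y
  | _ => if k is k'.+1 then solo k' p (c @@ p) else 0%Z
  end.

Lemma solo_decided k p c y : decided c p y -> solo k p c = chi y.
Proof. by rewrite /decided; case: k => [|k] /= ->. Qed.

Lemma soloS k p c : undecided p c -> solo k.+1 p c = solo k p (c @@ p).
Proof. by rewrite /undecided /pending /=; case: alg_step. Qed.

Lemma solo_agree k p c c' : agree (pred1 p) c c' -> solo k p c = solo k p c'.
Proof.
elim: k c c' => [|k IHk] c c' ag /=; rewrite (ag.1 p) //=.
by case: alg_step => // *; apply/IHk/agree_step => /=.
Qed.

Lemma solo_fuel k p c : bounded k c -> solo k.+1 p c = solo k p c.
Proof.
elim: k c => [|k IHk] c bc.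
  by have /negbTE/undecidedPn[y dy] := bc p; rewrite !(solo_decided _ dy).
case up: (undecided p c); first by rewrite (soloS _ up) (soloS k up); apply/IHk/bc.
by have [y dy] := undecidedPn up; rewrite !(solo_decided _ dy).
Qed.

Lemma solo_step p c : bounded F c -> solo F p (c @@ p) = solo F p c.
Proof.
move=> bc; case up: (undecided p c); last by rewrite step_decided ?up.
by rewrite -soloS // solo_fuel.
Qed.

(** Makes the output of a solo run a genuine decision, to which validity applies. *)
Lemma solo_output x p c : bounded F c -> reachable x c ->
  exists c' y, [/\ reachable x c', decided c' p y & solo F p c = chi y].
Proof.
elim: F c => [|k IHk] c bc rc; case up: (undecided p c).
- by move: (bc p); rewrite up.
- by have [y dy] := undecidedPn up; exists c, y; rewrite (solo_decided _ dy).
- rewrite soloS //; apply: IHk; [exact: bc|exact: reachable_step].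
by have [y dy] := undecidedPn up; exists c, y; rewrite (solo_decided _ dy).
Qed.

(** The first solo step of [q] already erases the step of [p]; if [q] has decided, its output is
    fixed. *)
Lemma solo_hidden p q c : p != q -> bounded F c -> hidden p q c ->
  solo F q (c @@ p) = solo F q c.
Proof.
move=> npq bc hpq; case uq: (undecided q c).
  rewrite -solo_step; last exact: bounded_step.
  rewrite -[RHS]solo_step //; apply: solo_agree.
  apply: agreeS (hidden_agree npq hpq uq) => i /= /eqP->.
  by rewrite eq_sym.
have [y dy] := undecidedPn uq.
by rewrite (solo_decided _ dy) (solo_decided _ (decided_step p dy)).
Qed.

(** The sum along the path of outputs telescopes. In the commuting case the intermediate terms
    cancel, since a solo output is unchanged by a step of the process itself. *)
Lemma winding_coboundary x p q : p != q ->
  (forall c u v, reachable x c -> decided c p u -> decided c q v ->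
     w u v = (chi u - chi v)%Z) ->
  forall k c, bounded k c -> bounded F c -> reachable x c ->
  W p q c = (solo F p c - solo F q c)%Z.
Proof.
move=> npq wchi; have nqp : q != p by rewrite eq_sym.
have decided2 c : bounded F c -> reachable x c -> undecided p c = false ->
    undecided q c = false -> W p q c = (solo F p c - solo F q c)%Z.
  move=> bF rc /undecidedPn[u du] /undecidedPn[v dv].
  by rewrite (winding_decided bF du dv) (solo_decided _ du) (solo_decided _ dv) (wchi c).
elim=> [|k IHk] c bk bF rc.
  by apply: decided2 => //; apply/negbTE/bk.
have IH i : undecided i c ->
    W p q (c @@ i) = (solo F p (c @@ i) - solo F q (c @@ i))%Z.
  by move=> ui; apply: IHk; [exact: bk|exact: bounded_step|exact: reachable_step].
have [hpq|hqp|cpq|[up uq]] := pair_cases p q c; last exact: decided2.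
- rewrite (winding_hidden bF hpq) IH ?(hidden_undecided hpq) //.
  by rewrite solo_step // solo_hidden.
- rewrite windingC // (winding_hidden bF hqp) -windingC // IH ?(hidden_undecided hqp) //.
  by rewrite solo_step // solo_hidden.
rewrite (winding_commuting bF cpq); have /and4P[up uq _ _] := cpq.
rewrite !IH // IHk; last by do 2!apply: reachable_step.
- rewrite (solo_step q) ?(solo_step p) //; last exact: bounded_step.
  rewrite (solo_step q) //.
  rewrite (commuting_step npq cpq) (solo_step p); last exact: bounded_step.
  lia.
- by apply: bounded_step; apply: bk.
by do 2!apply: bounded_step.
Qed.

End Boundary.
End Cocycle.
End Executions.

(** * Shortest paths along an edge, label crossings and the given cycle *)

Lemma on_shortest_path_edge (V : finType) (e : rel V) (y a b : V) :
  a = b \/ e a b -> on_shortest_path e y a b -> y = a \/ y = b.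
Proof.
move=> ab [p [_ lastp yp minp]].
(* A competitor with at most one edge forces the shortest path to have no interior vertex. *)
have [q [eq lastq leq1]] : exists q, [/\ path e a q, last a q = b & size q <= 1].
  by case: ab => [->|eab]; [exists [::]|exists [:: b]; rewrite /= eab].
have := leq_trans (minp q eq lastq) leq1.
move: p yp lastp {minp} => [|z [|//]] /=; rewrite !inE.
  by move=> /eqP; left.
by case/pred2P=> -> <- _; [left|right].
Qed.

Section Labels.
Variables (V : finType) (e : rel V) (l : labelling V).

(* Counts the traversals of an edge between labels 0 and 1, with their sign. *)
Definition crossing (u v : V) : Z :=
  (Z.b2z ((nat_of_ord (l u) == 0) && (nat_of_ord (l v) == 1))%N
   - Z.b2z ((nat_of_ord (l u) == 1) && (nat_of_ord (l v) == 0))%N)%Z.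

Lemma crossingC u v : crossing u v = (- crossing v u)%Z.
Proof. by rewrite /crossing ![(nat_of_ord (l v) == _) && _]andbC; lia. Qed.

Lemma crossing_label u v u' v' : l u = l u' -> l v = l v' -> crossing u v = crossing u' v'.
Proof. by rewrite /crossing => -> ->. Qed.

Lemma crossing_eq0 u v : l u = l v -> crossing u v = 0%Z.
Proof. by move=> eq_l; have := crossingC u u; rewrite (crossing_label (erefl _) eq_l); lia. Qed.

(** Two of the three labels coincide, since the vertices either form a triangle or are not distinct;
    antisymmetry then cancels the terms. *)
Lemma crossing_triangle u v t : no_rainbow_triangle e l ->
  u = v \/ e u v -> v = t \/ e v t -> u = t \/ e u t ->
  (crossing u v + crossing v t + crossing t u = 0)%Z.
Proof.
move=> tri uv vt ut.
have eq_l : [\/ l u = l v, l v = l t | l u = l t].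
  case: uv => [->|uv]; first by constructor 1.
  case: vt => [->|vt]; first by constructor 2.
  case: ut => [->|ut]; first by constructor 3.
  have [|nuv] := eqVneq (l u) (l v); first by constructor 1.
  have [|nvt] := eqVneq (l v) (l t); first by constructor 2.
  have [|nut] := eqVneq (l u) (l t); first by constructor 3.
  by case: (tri u v t uv vt ut).
have := crossingC t u; case: eq_l => eq_l; rewrite (crossing_eq0 eq_l).
- by rewrite (crossing_label eq_l (erefl (l t))); lia.
- by rewrite (crossing_label (erefl (l u)) eq_l); lia.
have := crossingC v t; rewrite (crossing_label eq_l (erefl (l v))); lia.
Qed.

Lemma prev_at_last (T : eqType) (x y : T) p : x \notin p -> prev_at x x y p = last y p.
Proof.
elim: p y => [|z p IHp] y /=; first by rewrite eqxx.
by rewrite inE negb_or => /andP[/negbTE-> /IHp].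
Qed.

(** Away from the vertex labelled 1 nothing crosses, so [h] agrees on its two neighbours. The two
    edges at that vertex then have opposite potential differences, yet only the one towards label 0
    crosses. *)
Lemma lb_cycle_no_potential (h : V -> Z) c : lb_cycle e l c ->
  ~ (forall u v, e u v -> crossing u v = (h u - h v)%Z).
Proof.
move=> [[/andP[ec uc] szc] [cnt1 nbrs]] pot.
have /hasP[v0 v0c /eqP lv0] : has (fun v => nat_of_ord (l v) == 1) c.
  by rewrite has_count cnt1.
have := nbrs v0 v0c lv0; case/rot_to: v0c => i [|y s] def_c.
  by move: szc; rewrite -(size_rot i) def_c.
rewrite -(prev_rot i uc) -(next_rot i uc) def_c.
rewrite -(rot_uniq i) def_c cons_uniq in uc; case/andP: uc => v0s _.
rewrite -(rot_cycle i) def_c in ec.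
have : all (fun v => nat_of_ord (l v) != 1) (y :: s).
  have := cnt1; rewrite -(seq.permP (permEl (perm_rot i c))) def_c /= lv0.
  rewrite eqxx add1n => -[cnt0].
  rewrite (all_predC (fun v => nat_of_ord (l v) == 1)) has_count -leqNgt leqn0.
  by move/eqP: cnt0; rewrite addn_eq0 eqb0.
rewrite [next _ _]/= eqxx [prev _ _]/=.
rewrite -/(prev_at v0 v0 v0 (y :: s)) prev_at_last // => no1 ends.
move: ec; rewrite /= rcons_path => /and3P[ev0y es elast].
have const : h y = h (last y s).
  elim: s y no1 es {def_c v0s ends ev0y elast} => //= z s IHs y.
  case/and3P=> ly lz ls /andP[eyz es]; rewrite -(IHs z) //=; last by rewrite lz.
  by have := pot _ _ eyz; rewrite /crossing (negbTE ly) (negbTE lz) andbF /=; lia.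
have := pot _ _ ev0y; have := pot _ _ elast; rewrite /crossing lv0.
by case: ends => -[-> ->]; rewrite const /=; lia.
Qed.

End Labels.

(** * Impossibility: a potential built from the initial windings *)

Theorem mainTheorem5 (V : finType) (e : rel V) :
  simple_graph e -> connected_graph e ->
  (exists l : labelling V, lower_bound_labelling e l) ->
  forall n : nat, 3 <= n -> forall A : algorithm n V, ~ solves_gaa e A.
Proof.
move=> [sym_e _] _ [l [tri [c cyc]]] n n3 A [wf [agr val]].
pose p0 : 'I_n := Ordinal (ltnW (ltnW n3)).
pose p1 : 'I_n := Ordinal (ltnW n3).
pose p2 : 'I_n := Ordinal n3.
(* Every process other than [p1] and [p2] shares the input of [p0], so only three values occur. *)
pose inp (t : V * V * V) (i : 'I_n) :=
  if i == p1 then t.1.2 else if i == p2 then t.2 else t.1.1.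
pose conf a b d := init A (inp (a, b, d)).
(* As [V] is finite, one fuel suffices for all triples of inputs. *)
have [F bF] : exists F, forall a b d, bounded F (conf a b d).
  pose k t := proj1_sig (constructive_indefinite_description _
    (wait_free_bounded (inp t) wf)).
  exists (\max_t k t) => a b d; apply: (@bounded_leq _ _ _ (k (a, b, d))).
    exact: (leq_bigmax (F := k) (a, b, d)).
  by rewrite /k; case: constructive_indefinite_description.
have wC := crossingC l; pose W := @winding n V A (crossing l) F.
have cocycle0 a b d : (W p0 p1 (conf a b d) + W p1 p2 (conf a b d)
    + W p2 p0 (conf a b d) = 0)%Z.
  apply: (reachable_cocycle wC (x := inp (a, b, d)) _ (bF a b d) (bF a b d)) => //.
    move=> c' i j k u v t [sched [m ->]] du dv dt.
    by apply: (crossing_triangle tri); apply: agr; eassumption.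
  exact: reachable_init p0.
have output x (c' : config A) i y a b : reachable x c' -> decided c' i y ->
    (forall j, x j = a \/ x j = b) -> a = b \/ e a b -> y = a \/ y = b.
  move=> [sched [m ->]] /val[j [j' yjj']] xab eab.
  have : y = x j \/ y = x j'.
    apply: on_shortest_path_edge yjj'.
    case: (xab j) (xab j') => [] -> [] ->; [by left|by []|idtac|by left].
    by rewrite sym_e; case: eab => [->|]; [left|right].
  by case: (xab j) (xab j') => [] -> [] ->; tauto.
have inp_const v j : inp (v, v, v) j = v by rewrite /inp /=; do 2?case: (_ == _).
have solo_input chi a b d i : i = p0 \/ i = p1 ->
    solo chi F i (conf a b d) = chi (inp (a, b, d) i).
  move=> i01; set v := inp _ _.
  (* Running alone, [i] cannot distinguish this configuration from the one where all inputs are [v],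
     and there validity forces the output [v]. *)
  have -> : solo chi F i (conf a b d) = solo chi F i (conf v v v).
    apply: solo_agree; split=> //= _ /eqP->; congr alg_init.
    by rewrite inp_const.
  have [c' [y [rc' dy ->]]] := solo_output chi i (bF v v v)
    (reachable_init A (inp (v, v, v)) p0).
  have inv j : inp (v, v, v) j = v \/ inp (v, v, v) j = v.
    by left; rewrite inp_const.
  by case: (output _ _ _ _ _ _ rc' dy inv (or_introl erefl)) => ->.
have edge a b : a = b \/ e a b -> W p0 p1 (conf a b a) = crossing l a b.
  (* With inputs [a] and [b] only, all outputs are [a] or [b], and on these two vertices
     [crossing l] is the coboundary of [chi]. *)
  move=> ab; pose chi u := crossing l u b.
  have cr0 u : crossing l u u = 0%Z by apply: crossing_eq0.
  have inab j : inp (a, b, a) j = a \/ inp (a, b, a) j = b.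
    by rewrite /inp /=; do 2?case: (_ == _); tauto.
  rewrite /W (winding_coboundary wC (chi := chi) (x := inp (a, b, a)) _ _ (bF a b a)) //.
  - by rewrite !solo_input; [rewrite /inp /chi /= cr0; lia|right|left].
  - move=> c' u v rc' du dv.
    have := output _ _ _ _ _ _ rc' du inab ab.
    have := output _ _ _ _ _ _ rc' dv inab ab; rewrite /chi.
    by case=> -> [] ->; rewrite ?cr0 //; have := wC a b; lia.
  exact: reachable_init p0.
have [v0 _] : exists v, v \in c.
  by case: c cyc => [[[_ //]]|v c _]; exists v; rewrite mem_head.
have Wconf i j a b d a' b' d' : inp (a, b, d) i = inp (a', b', d') i ->
    inp (a, b, d) j = inp (a', b', d') j -> W i j (conf a b d) = W i j (conf a' b' d').
  move=> eqi eqj; apply: winding_agree.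
  by split=> //= k /pred2P[]->; congr alg_init.
(* The input of [p2] is fixed to [v0]. By [Wconf] the input of the process outside the pair is
   irrelevant and is also set to [v0]. *)
pose h a := (- W p2 p0 (conf a v0 v0))%Z; pose h' b := W p1 p2 (conf v0 b v0).
have hh' a b : a = b \/ e a b -> crossing l a b = (h a - h' b)%Z.
  move=> /edge<-; rewrite (Wconf p0 p1 a b a a b v0) // /h /h'.
  rewrite (Wconf p2 p0 a v0 v0 a b v0) // (Wconf p1 p2 v0 b v0 a b v0) //.
  by have := cocycle0 a b v0; lia.
(* Equal inputs [a] and [a] give crossing 0, which identifies the two potentials. *)
have eq_h a : h a = h' a.
  by have := hh' a a (or_introl erefl); rewrite crossing_eq0 //; lia.
apply: (lb_cycle_no_potential (h := h) cyc) => a b eab.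
by rewrite hh' ?eq_h //; right.
Qed.
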